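(* Let $\mathcal{T}$ be a theory over a countable algebraic signature $\Sigma$, and let $S$ be a set of sorts of $\Sigma$. If $\mathcal{T}$ is strongly polite with respect to $S$, then $\mathcal{T}$ is additively polite with respect to $S$.
   Context: Many-sorted first-order logic with equality. A signature $\Sigma$ has a non-empty set of sorts, function symbols and predicate symbols (including equality for each sort); it is countable if the union of these sets is countable, and algebraic if it has no predicate symbols other than equalities. A $\Sigma$-interpretation is a structure (non-empty domain $\sigma^{\mathcal{A}}$ per sort) plus an assignment to variables. A $\Sigma$-theory $\mathcal{T}$ is the class of $\Sigma$-interpretations satisfying a set of sentences; members are $\mathcal{T}$-interpretations. Formulas are $\mathcal{T}$-equivalent if satisfied by the same $\mathcal{T}$-interpretations. $\mathrm{QF}(\Sigma)$ is the set of quantifier-free formulas; $\mathrm{vars}_\sigma(\varphi)$ is the set of free variables of sort $\sigma$ in $\varphi$. For $S$ a set of sorts: $\mathcal{T}$ is smooth w.r.t. $S$ if for every quantifier-free $\varphi$, $\mathcal{T}$-interpretation $\mathcal{A}\models\varphi$ and function $\kappa$ from $S$ to cardinals with $\kappa(\sigma)\ge|\sigma^{\mathcal{A}}|$, there is a $\mathcal{T}$-interpretation $\mathcal{B}\models\varphi$ with $|\sigma^{\mathcal{B}}|=\kappa(\sigma)$ for all $\sigma\in S$. For a finite set $V$ of variables and an equivalence relation $E$ on $V$ relating only variables of the same sort, the arrangement $\delta_V^E$ is the conjunction of $x=y$ for $xEy$ and $\neg(x=y)$ for $x,y$ not $E$-related. A witness w.r.t. $S$ is a computable function $\mathit{wit}:\mathrm{QF}(\Sigma)\to\mathrm{QF}(\Sigma)$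 such that for each $\varphi$: $\varphi$ and $\exists\vec{x}\,\mathit{wit}(\varphi)$ are $\mathcal{T}$-equivalent, where $\vec{x}=\mathrm{vars}(\mathit{wit}(\varphi))\setminus\mathrm{vars}(\varphi)$; and if $\mathit{wit}(\varphi)$ is $\mathcal{T}$-satisfiable then some $\mathcal{T}$-interpretation $\mathcal{A}$ satisfies $\mathit{wit}(\varphi)$ with $\sigma^{\mathcal{A}}=\mathrm{vars}_\sigma(\mathit{wit}(\varphi))^{\mathcal{A}}$ for each $\sigma\in S$. A strong witness is a witness such that for every $\varphi$, every finite set $V$ of variables with sorts in $S$ and every arrangement $\delta_V$ on $V$, if $\mathit{wit}(\varphi)\wedge\delta_V$ is $\mathcal{T}$-satisfiable then some $\mathcal{T}$-interpretation $\mathcal{A}$ satisfies it with $\sigma^{\mathcal{A}}=\mathrm{vars}_\sigma(\mathit{wit}(\varphi)\wedge\delta_V)^{\mathcal{A}}$ for each $\sigma\in S$. $\mathcal{T}$ is strongly polite w.r.t. $S$ if it is smooth and has a strong witness w.r.t. $S$. A function $f:\mathrm{QF}(\Sigma)\to\mathrm{QF}(\Sigma)$ is $S$-additive for $\mathcal{T}$ if for all $\varphi,\psi\in\mathrm{QF}(\Sigma)$ with $\psi$ a conjunction of flat literals in which every term is a variable of sort in $S$, the formulas $f(f(\varphi)\wedge\psi)$ and $f(\varphi)\wedge\psi$ are $\mathcal{T}$-equivalent and have the same set of variables with sorts in $S$. $\mathcal{T}$ is additively polite w.r.t. $S$ if it is smooth and has an $S$-additive witness w.r.t. $S$. *)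

(* Defs.v *)
From mathcomp Require Import all_boot.
From Stdlib Require Cantor.

Set Implicit Arguments.
Unset Strict Implicit.
Unset Printing Implicit Defensive.

(* Equality at each sort is a logical symbol (constructor [Eq] of [formula]),
   so [psym] lists only the other predicate symbols. *)
Record signature := Signature {
  sorts : eqType;
  sorts_inh : inhabited sorts;
  fsym : Type;
  fdom : fsym -> seq sorts;
  fcod : fsym -> sorts;
  psym : Type;
  pdom : psym -> seq sorts }.

Definition algebraic (Sg : signature) : Prop := psym Sg -> False.

(* A signature is countable when it has a numbering.  Computability of
   functions on formulas is relative to a numbering of the symbols. *)
Record numbering (Sg : signature) := Numbering {
  sort_num : sorts Sg -> nat;
  sort_num_inj : injective sort_num;
  fsym_num : fsym Sg -> nat;
  fsym_num_inj : injective fsym_num;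
  psym_num : psym Sg -> nat;
  psym_num_inj : injective psym_num }.

Section Syntax.
Variable Sg : signature.

(* The pair (s, n) is the n-th variable of sort s. *)
Definition var : eqType := (sorts Sg * nat)%type.

Inductive term : sorts Sg -> Type :=
| Var (s : sorts Sg) (n : nat) : term s
| App (f : fsym Sg) : terms (fdom f) -> term (fcod f)
with terms : seq (sorts Sg) -> Type :=
| TNil : terms [::]
| TCons (s : sorts Sg) (ss : seq (sorts Sg)) :
    term s -> terms ss -> terms (s :: ss).

Inductive formula : Type :=
| Top | Bot
| Eq (s : sorts Sg) (t u : term s)
| Rel (p : psym Sg) (ts : terms (pdom p))
| Not (phi : formula)
| And (phi psi : formula)
| Or (phi psi : formula)
| Imp (phi psi : formula)
| Ex (x : var) (phi : formula)
| All (x : var) (phi : formula).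

Fixpoint term_vars s (t : term s) : seq var :=
  match t with
  | Var s n => [:: (s, n)]
  | App f ts => terms_vars ts
  end
with terms_vars ss (ts : terms ss) : seq var :=
  match ts with
  | TNil => [::]
  | TCons s ss t ts => term_vars t ++ terms_vars ts
  end.

Fixpoint vars (phi : formula) : seq var :=
  match phi with
  | Top | Bot => [::]
  | Eq s t u => term_vars t ++ term_vars u
  | Rel p ts => terms_vars ts
  | Not phi => vars phi
  | And phi psi | Or phi psi | Imp phi psi => vars phi ++ vars psi
  | Ex x phi | All x phi => [seq y <- vars phi | y != x]
  end.

Fixpoint quantifier_free (phi : formula) : bool :=
  match phi with
  | Top | Bot | Eq _ _ _ | Rel _ _ => true
  | Not phi => quantifier_free phi
  | And phi psi | Or phi psi | Imp phi psi =>
      quantifier_free phi && quantifier_free psi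
  | Ex _ _ | All _ _ => false
  end.

Record QF := MkQF {
  qf_formula :> formula;
  qf_formulaP : quantifier_free qf_formula }.

Lemma qf_andP (phi psi : QF) : quantifier_free (And phi psi).
Proof. by rewrite /= !qf_formulaP. Qed.

Definition qf_and (phi psi : QF) : QF := MkQF (qf_andP phi psi).

Definition exs (xs : seq var) (phi : formula) : formula := foldr Ex phi xs.

Definition conj (phis : seq formula) : formula := foldr And Top phis.

Definition eq_var (x y : var) : formula := Eq (Var x.1 x.2) (Var x.1 y.2).

(* Only pairs of variables of the same sort contribute a literal, so
   [eq_var x y] really is the equation x = y. *)
Definition arrangement (V : seq var) (E : rel var) : formula :=
  conj [seq if E p.1 p.2 then eq_var p.1 p.2 else Not (eq_var p.1 p.2)
       | p <- [seq (x, y) | x <- V, y <- V] & p.1.1 == p.2.1].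

Definition arrangement_rel (V : seq var) (E : rel var) : Prop :=
  {in V & &, equivalence_rel E} /\ {in V &, forall x y, E x y -> x.1 = y.1}.

Definition is_var s (t : term s) : Prop := exists n, t = Var s n.

Fixpoint terms_all (P : forall s, term s -> Prop) ss (ts : terms ss) : Prop :=
  match ts with
  | TNil => True
  | TCons s ss t ts => P s t /\ terms_all P ts
  end.

Inductive flat_literal : formula -> Prop :=
| flat_eq s m n : flat_literal (Eq (Var s m) (Var s n))
| flat_neq s m n : flat_literal (Not (Eq (Var s m) (Var s n)))
| flat_app f n (ts : terms (fdom f)) :
    terms_all is_var ts -> flat_literal (Eq (Var (fcod f) n) (App ts))
| flat_rel p (ts : terms (pdom p)) :
    terms_all is_var ts -> flat_literal (Rel ts)
| flat_nrel p (ts : terms (pdom p)) :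
    terms_all is_var ts -> flat_literal (Not (Rel ts)).

(* Conjunctions may be bracketed arbitrarily; the empty one is [Top]. *)
Inductive flat_conjunction : formula -> Prop :=
| fconj_nil : flat_conjunction Top
| fconj_lit phi : flat_literal phi -> flat_conjunction phi
| fconj_and phi psi : flat_conjunction phi -> flat_conjunction psi ->
    flat_conjunction (And phi psi).

Fixpoint all_terms (P : forall s, term s -> Prop) (phi : formula) : Prop :=
  match phi with
  | Top | Bot => True
  | Eq s t u => P s t /\ P s u
  | Rel p ts => terms_all P ts
  | Not phi => all_terms P phi
  | And phi psi | Or phi psi | Imp phi psi =>
      all_terms P phi /\ all_terms P psi
  | Ex _ phi | All _ phi => all_terms P phi
  end.

Definition only_vars_in (S : sorts Sg -> Prop) : formula -> Prop :=
  all_terms (fun s t => S s /\ is_var t).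

End Syntax.

Arguments Top {Sg}.
Arguments Bot {Sg}.

(* Domains of structures and cardinals (see [smooth]) are types of one and the
   same universe. *)
Definition carrier := Type.

Section Semantics.
Variable Sg : signature.

Fixpoint tuple_of_sorts (D : sorts Sg -> Type) (ss : seq (sorts Sg)) : Type :=
  match ss with
  | [::] => unit
  | s :: ss => (D s * tuple_of_sorts D ss)%type
  end.

Record structure := Structure {
  dom : sorts Sg -> carrier;
  dom_inh : forall s, inhabited (dom s);
  finterp : forall f : fsym Sg, tuple_of_sorts dom (fdom f) -> dom (fcod f);
  pinterp : forall p : psym Sg, tuple_of_sorts dom (pdom p) -> Prop }.

Definition assignment (M : structure) := forall x : var Sg, dom M x.1.

Record interpretation := Interpretation {
  struct :> structure;
  assign : assignment struct }.

Fixpoint eval (M : structure) (nu : assignment M) s (t : term s) : dom M s :=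
  match t with
  | Var s n => nu (s, n)
  | App f ts => finterp (evals nu ts)
  end
with evals (M : structure) (nu : assignment M) ss (ts : terms ss) :
    tuple_of_sorts (dom M) ss :=
  match ts with
  | TNil => tt
  | TCons s ss t ts => (eval nu t, evals nu ts)
  end.

Definition variant (M : structure) (x : var Sg) (nu mu : assignment M) : Prop :=
  forall y, y != x -> mu y = nu y.

Fixpoint holds (M : structure) (nu : assignment M) (phi : formula Sg) : Prop :=
  match phi with
  | Top => True
  | Bot => False
  | Eq s t u => eval nu t = eval nu u
  | Rel p ts => pinterp (evals nu ts)
  | Not phi => ~ holds nu phi
  | And phi psi => holds nu phi /\ holds nu psi
  | Or phi psi => holds nu phi \/ holds nu psi
  | Imp phi psi => holds nu phi -> holds nu psi
  | Ex x phi => exists mu, variant x nu mu /\ holds mu phi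
  | All x phi => forall mu, variant x nu mu -> holds mu phi
  end.

Definition sat (A : interpretation) (phi : formula Sg) : Prop :=
  holds (@assign A) phi.

Record theory := Theory {
  axioms : formula Sg -> Prop;
  axioms_closed : forall phi, axioms phi -> vars phi = [::] }.

(* [A] is a T-interpretation. *)
Definition in_theory (T : theory) (A : interpretation) : Prop :=
  forall phi, axioms T phi -> sat A phi.

Definition T_equiv (T : theory) (phi psi : formula Sg) : Prop :=
  forall A, in_theory T A -> (sat A phi <-> sat A psi).

Definition T_sat (T : theory) (phi : formula Sg) : Prop :=
  exists A, in_theory T A /\ sat A phi.

(* The cardinal kappa s is represented by a type of that cardinality. *)
Definition smooth (T : theory) (S : sorts Sg -> Prop) : Prop :=
  forall (phi : QF Sg) (A : interpretation) (kappa : sorts Sg -> carrier),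
    in_theory T A -> sat A phi ->
    (forall s, S s -> exists g : dom A s -> kappa s, injective g) ->
    exists B : interpretation, [/\ in_theory T B, sat B phi &
      forall s, S s -> exists g : dom B s -> kappa s, bijective g].

(* For each sort s in S, the domain of s is the set of values of the free
   variables of sort s of [phi]. *)
Definition domain_by_vars (S : sorts Sg -> Prop) (A : interpretation)
    (phi : formula Sg) : Prop :=
  forall s, S s -> forall a : dom A s,
    exists n, (s, n) \in vars phi /\ @assign A (s, n) = a.

End Semantics.

(* Partial recursive functions.  A program acts on lists of arguments; running
   it on too few arguments has no result.  In [Prec f g] the recursion is on
   the first argument:
     h (0, xs) = f xs   and   h (n + 1, xs) = g (n, h (n, xs), xs). *)
Inductive recprog : Type :=
| Zero
| Succ
| Proj (i : nat)
| Comp (f : recprog) (gs : seq recprog)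
| Prec (f g : recprog)
| Mu (f : recprog).

Inductive run : recprog -> seq nat -> nat -> Prop :=
| run_zero xs : run Zero xs 0
| run_succ x xs : run Succ (x :: xs) x.+1
| run_proj i xs : i < size xs -> run (Proj i) xs (nth 0 xs i)
| run_comp f gs xs ys z :
    runs gs xs ys -> run f ys z -> run (Comp f gs) xs z
| run_prec0 f g xs z : run f xs z -> run (Prec f g) (0 :: xs) z
| run_precS f g n xs y z :
    run (Prec f g) (n :: xs) y -> run g [:: n, y & xs] z ->
    run (Prec f g) (n.+1 :: xs) z
| run_mu f xs n :
    run f (n :: xs) 0 ->
    (forall m, m < n -> exists k, run f (m :: xs) k.+1) ->
    run (Mu f) xs n
with runs : seq recprog -> seq nat -> seq nat -> Prop :=
| runs_nil xs : runs [::] xs [::]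
| runs_cons g gs xs y ys :
    run g xs y -> runs gs xs ys -> runs (g :: gs) xs (y :: ys).

Section Goedel.
Variables (Sg : signature) (N : numbering Sg).

Definition pair_num (m n : nat) : nat := Cantor.to_nat (m, n).

Fixpoint term_num s (t : term s) : nat :=
  match t with
  | Var s n => pair_num 0 (pair_num (sort_num N s) n)
  | App f ts => pair_num 1 (pair_num (fsym_num N f) (terms_num ts))
  end
with terms_num ss (ts : terms ss) : nat :=
  match ts with
  | TNil => 0
  | TCons s ss t ts => (pair_num (term_num t) (terms_num ts)).+1
  end.

Definition var_num (x : var Sg) : nat := pair_num (sort_num N x.1) x.2.

Fixpoint formula_num (phi : formula Sg) : nat :=
  match phi with
  | Top => pair_num 0 0
  | Bot => pair_num 1 0
  | Eq s t u => pair_num 2 (pair_num (term_num t) (term_num u))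
  | Rel p ts => pair_num 3 (pair_num (psym_num N p) (terms_num ts))
  | Not phi => pair_num 4 (formula_num phi)
  | And phi psi => pair_num 5 (pair_num (formula_num phi) (formula_num psi))
  | Or phi psi => pair_num 6 (pair_num (formula_num phi) (formula_num psi))
  | Imp phi psi => pair_num 7 (pair_num (formula_num phi) (formula_num psi))
  | Ex x phi => pair_num 8 (pair_num (var_num x) (formula_num phi))
  | All x phi => pair_num 9 (pair_num (var_num x) (formula_num phi))
  end.

(* The behaviour of [p] on numbers that are not Goedel numbers of
   quantifier-free formulas is unconstrained. *)
Definition computable (f : QF Sg -> QF Sg) : Prop :=
  exists p : recprog,
    forall phi : QF Sg, run p [:: formula_num phi] (formula_num (f phi)).

End Goedel.

Section Politeness.
Variables (Sg : signature) (N : numbering Sg).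
Variables (T : theory Sg) (S : sorts Sg -> Prop).

Definition witness (wit : QF Sg -> QF Sg) : Prop :=
  computable N wit /\
  forall phi : QF Sg,
    T_equiv T phi
      (exs (undup [seq x <- vars (wit phi) | x \notin vars phi]) (wit phi)) /\
    (T_sat T (wit phi) ->
     exists A, [/\ in_theory T A, sat A (wit phi) &
                   domain_by_vars S A (wit phi)]).

Definition strong_witness (wit : QF Sg -> QF Sg) : Prop :=
  witness wit /\
  forall (phi : QF Sg) (V : seq (var Sg)) (E : rel (var Sg)),
    (forall x, x \in V -> S x.1) -> arrangement_rel V E ->
    T_sat T (And (wit phi) (arrangement V E)) ->
    exists A, [/\ in_theory T A, sat A (And (wit phi) (arrangement V E)) &
                  domain_by_vars S A (And (wit phi) (arrangement V E))].

Definition additive (f : QF Sg -> QF Sg) : Prop :=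
  forall phi psi : QF Sg,
    flat_conjunction psi -> only_vars_in S psi ->
    T_equiv T (f (qf_and (f phi) psi)) (qf_and (f phi) psi) /\
    (forall x : var Sg, S x.1 ->
       (x \in vars (f (qf_and (f phi) psi))) =
       (x \in vars (qf_and (f phi) psi))).

Definition strongly_polite : Prop :=
  smooth T S /\ exists wit, strong_witness wit.

Definition additively_polite : Prop :=
  smooth T S /\ exists wit, witness wit /\ additive wit.

End Politeness.

(* Main.v *)
(* If T is consistent, S is finite, because the values of finitely many
   variables exhaust a model of wit(Top).  Hence membership in S is decidable.
   The new witness maps phi to [(Top \/ phi) /\ (wit(phi) /\ Top)], whose first
   conjunct records phi, so that formulas [((Top \/ phi) /\ (wit(phi) /\ psi)) /\ psi'],
   with psi and psi' Boolean combinations of equations between variables of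
   sorts in S, can be recognized and mapped to
   [(Top \/ phi) /\ (wit(phi) /\ (psi /\ psi'))] instead.  Additivity is then
   immediate.  The truth of psi is determined by the arrangement of its variables,
   so strength of wit provides the required models of wit(phi) /\ psi. *)

Require Import Defs.
From mathcomp Require Import all_boot.
From Stdlib Require Import Classical ClassicalDescription IndefiniteDescription.
From Stdlib Require Cantor.
From mathcomp Require Import zify.

Set Implicit Arguments.
Unset Strict Implicit.
Unset Printing Implicit Defensive.

(** * Total recursive functions *)

(** Only the values of [F] on lists of length [k] matter. Boolean functions are covered through the
    coercion to numbers. *)
Definition recursive k (F : seq nat -> nat) : Prop :=
  exists p, forall xs, size xs = k -> run p xs (F xs).

Definition recursive1 (f : nat -> nat) := recursive 1 (fun xs => f (nth 0 xs 0)).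
Definition recursive2 (f : nat -> nat -> nat) :=
  recursive 2 (fun xs => f (nth 0 xs 0) (nth 0 xs 1)).
Definition recursive3 (f : nat -> nat -> nat -> nat) :=
  recursive 3 (fun xs => f (nth 0 xs 0) (nth 0 xs 1) (nth 0 xs 2)).

Lemma recursive_nth k i : i < k -> recursive k (fun xs => nth 0 xs i).
Proof. by move=> ik; exists (Proj i) => xs sz; apply: run_proj; rewrite sz. Qed.

Lemma recursive_const k c : recursive k (fun=> c).
Proof.
elim: c => [|c [p hp]]; first by exists Zero => xs _; apply: run_zero.
exists (Comp Succ [:: p]) => xs sz; apply: (@run_comp _ _ _ [:: c]).
  by apply: runs_cons; [apply: hp | apply: runs_nil].
exact: run_succ.
Qed.

Section Composition.
Variable k : nat.

Lemma recursive_app1 f a :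
  recursive1 f -> recursive k a -> recursive k (fun xs => f (a xs)).
Proof.
move=> [p hp] [q hq]; exists (Comp p [:: q]) => xs sz.
apply: (run_comp _ (hp [:: a xs] erefl)).
by apply: runs_cons; [apply: hq | apply: runs_nil].
Qed.

Lemma recursive_app2 f a b :
  recursive2 f -> recursive k a -> recursive k b ->
  recursive k (fun xs => f (a xs) (b xs)).
Proof.
move=> [p hp] [q hq] [r hr]; exists (Comp p [:: q; r]) => xs sz.
apply: (run_comp _ (hp [:: a xs; b xs] erefl)).
apply: runs_cons; first exact: hq.
by apply: runs_cons; [apply: hr | apply: runs_nil].
Qed.

End Composition.

Lemma recursive1_rec c g h :
  recursive2 g -> h 0 = c -> (forall n, h n.+1 = g n (h n)) -> recursive1 h.
Proof.
move=> [q hq] h0 hS; have [p hp] := recursive_const 0 c.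
exists (Prec p q) => -[|n []] // _ /=; elim: n => [|n IH].
  by rewrite h0; apply: run_prec0; apply: hp.
by rewrite hS; apply: run_precS IH _; apply: (hq [:: n; h n]).
Qed.

Lemma recursive2_rec f g h :
  recursive1 f -> recursive3 g -> (forall x, h 0 x = f x) ->
  (forall n x, h n.+1 x = g n (h n x) x) -> recursive2 h.
Proof.
move=> [p hp] [q hq] h0 hS.
exists (Prec p q) => -[|n [|x []]] // _ /=; elim: n => [|n IH].
  by rewrite h0; apply: run_prec0; apply: (hp [:: x]).
by rewrite hS; apply: run_precS IH _; apply: (hq [:: n; h n x; x]).
Qed.

Lemma recursive_succ : recursive1 succn.
Proof. by exists Succ => -[|x []] // _; apply: run_succ. Qed.

Lemma recursive_add : recursive2 addn.
Proof.
apply: (@recursive2_rec id (fun _ y _ => y.+1)) => //; first exact: recursive_nth.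
by apply: (recursive_app1 recursive_succ); apply: recursive_nth.
Qed.

Lemma recursive_mul : recursive2 muln.
Proof.
apply: (@recursive2_rec (fun=> 0) (fun _ y x => x + y)) => //; first exact: recursive_const.
by apply: (recursive_app2 recursive_add); apply: recursive_nth.
Qed.

Lemma recursive_pred : recursive1 predn.
Proof. by apply: (@recursive1_rec 0 (fun n _ => n)) => //; apply: recursive_nth. Qed.

Lemma recursive_sub : recursive2 subn.
Proof.
(* [Prec] recurses on the first argument, so subtraction is first built with its arguments
   swapped. *)
have rsub : recursive2 (fun n x => x - n).
  apply: (@recursive2_rec id (fun _ y _ => y.-1)) => [||x|n x]; first exact: recursive_nth.
  - by apply: (recursive_app1 recursive_pred); apply: recursive_nth.
  - by rewrite subn0.
  - by rewrite subnS.
by apply: (recursive_app2 rsub); apply: recursive_nth.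
Qed.

Lemma eq_recursive k F G : F =1 G -> recursive k F -> recursive k G.
Proof. by move=> FG [p hp]; exists p => xs sz; rewrite -FG; apply: hp. Qed.

Section Booleans.
Variable k : nat.
Implicit Types b c : seq nat -> bool.

Lemma recursive_eq f g :
  recursive k f -> recursive k g -> recursive k (fun xs => f xs == g xs).
Proof.
move=> rf rg.
(* Both truncated differences vanish exactly when the two values are equal. *)
apply: (@eq_recursive _ (fun xs => 1 - ((f xs - g xs) + (g xs - f xs)))) => [xs|].
  by case: eqP; lia.
apply: (recursive_app2 recursive_sub (recursive_const _ 1)).
by apply: (recursive_app2 recursive_add); apply: (recursive_app2 recursive_sub).
Qed.

Lemma recursive_and b c :
  recursive k b -> recursive k c -> recursive k (fun xs => b xs && c xs).
Proof.
move=> rb rc; apply: eq_recursive (recursive_app2 recursive_mul rb rc) => xs.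
by case: (b xs) (c xs) => -[].
Qed.

Lemma recursive_if b f g :
  recursive k b -> recursive k f -> recursive k g ->
  recursive k (fun xs => if b xs then f xs else g xs).
Proof.
move=> rb rf rg.
apply: (@eq_recursive _ (fun xs => b xs * f xs + (1 - b xs) * g xs)) => [xs|].
  by case: (b xs); lia.
apply: (recursive_app2 recursive_add); first exact: (recursive_app2 recursive_mul).
apply: (recursive_app2 recursive_mul) => //.
by apply: (recursive_app2 recursive_sub) => //; apply: recursive_const.
Qed.

Lemma recursive_or b c :
  recursive k b -> recursive k c -> recursive k (fun xs => b xs || c xs).
Proof.
move=> rb rc; apply: eq_recursive (recursive_if rb (recursive_const _ 1) rc) => xs.
by case: (b xs).
Qed.

Lemma recursive_mem (l : seq nat) f :
  recursive k f -> recursive k (fun xs => f xs \in l).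
Proof.
move=> rf; elim: l => [|x l IH]; first exact: recursive_const.
apply: (@eq_recursive _ (fun xs => (f xs == x) || (f xs \in l))) => //.
by apply: recursive_or IH; apply: recursive_eq => //; apply: recursive_const.
Qed.

End Booleans.

Create HintDb recursive.

(* Syntactic matching keeps [apply] from unfolding arithmetic functions. *)
Ltac recursive :=
  cbv beta delta [recursive1 recursive2 recursive3];
  repeat lazymatch goal with
  | |- recursive _ (fun=> ?c) => exact: recursive_const
  | |- recursive _ (fun xs => nth 0 xs _) => exact: recursive_nth
  | |- recursive _ (fun xs => if _ then _ else _) => apply: recursive_if
  | |- recursive _ (fun xs => nat_of_bool (_ && _)) => apply: recursive_and
  | |- recursive _ (fun xs => nat_of_bool (_ || _)) => apply: recursive_or
  | |- recursive _ (fun xs => nat_of_bool (_ \in _)) => apply: recursive_mem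
  | |- recursive _ (fun xs => nat_of_bool (_ == _)) => apply: recursive_eq
  | |- recursive _ (fun xs => @?f xs) =>
      match f with
      | (fun xs => ?g (@?a xs) (@?b xs)) =>
          apply: (@recursive_app2 _ g a b); first by auto with recursive nocore
      | (fun xs => ?g (@?a xs)) =>
          apply: (@recursive_app1 _ g a); first by auto with recursive nocore
      end
  end.

#[local] Hint Resolve recursive_succ recursive_add recursive_mul : recursive.
#[local] Hint Resolve recursive_pred recursive_sub : recursive.

(** * Cantor pairing *)

Definition unpair1 n := (Cantor.of_nat n).1.
Definition unpair2 n := (Cantor.of_nat n).2.

Lemma unpair1K m n : unpair1 (pair_num m n) = m.
Proof. by rewrite /unpair1 /pair_num Cantor.cancel_of_to. Qed.

Lemma unpair2K m n : unpair2 (pair_num m n) = n.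
Proof. by rewrite /unpair2 /pair_num Cantor.cancel_of_to. Qed.

Lemma unpairK n : pair_num (unpair1 n) (unpair2 n) = n.
Proof. by rewrite /pair_num -surjective_pairing Cantor.cancel_to_of. Qed.

Lemma pair_num_inj m n m' n' :
  pair_num m n = pair_num m' n' -> m = m' /\ n = n'.
Proof. by move=> /Cantor.to_nat_inj[-> ->]. Qed.

(** The triangular number [n (n + 1) / 2], at which the [n]-th antidiagonal of the Cantor
    enumeration starts. *)
Fixpoint triangle n := if n is m.+1 then n + triangle m else 0.

Lemma pair_numE m n : pair_num m n = n + triangle (n + m).
Proof. by rewrite /pair_num /= !plusE; congr addn; elim: (n + m) => //= k ->. Qed.

Lemma leq_triangle n : n <= triangle n.
Proof. by case: n => //= n; lia. Qed.

Lemma leq_pair1 m n : m <= pair_num m n.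
Proof. by rewrite pair_numE; have := leq_triangle (n + m); lia. Qed.

Lemma leq_pair2 m n : n <= pair_num m n.
Proof. by rewrite pair_numE; lia. Qed.

Lemma ltn_pair2 m n : 0 < m -> n < pair_num m n.
Proof. by rewrite pair_numE; have := leq_triangle (n + m); lia. Qed.

Lemma recursive_triangle : recursive1 triangle.
Proof. by apply: (@recursive1_rec 0 (fun n y => n.+1 + y)) => //; recursive. Qed.

#[local] Hint Resolve recursive_triangle : recursive.

Lemma recursive_pair : recursive2 pair_num.
Proof.
apply: (@eq_recursive _ (fun xs => nth 0 xs 1 + triangle (nth 0 xs 1 + nth 0 xs 0))).
  by move=> xs; rewrite pair_numE.
by recursive.
Qed.

(** The index of the antidiagonal has a simple recursion, and both projections follow from it by
    subtraction. *)
Definition diagonal n := unpair1 n + unpair2 n.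

Lemma unpair2E n : unpair2 n = n - triangle (diagonal n).
Proof.
by rewrite -[X in X - _](unpairK n) pair_numE (addnC _ (unpair1 n)) addnK.
Qed.

Lemma unpair1E n : unpair1 n = diagonal n - unpair2 n.
Proof. by rewrite addnK. Qed.

(** The [d]-th antidiagonal ends at [triangle d + d], and the successor of this number starts the
    next one. *)
Lemma diagonalS n :
  diagonal n.+1 =
    if n == triangle (diagonal n) + diagonal n then (diagonal n).+1 else diagonal n.
Proof.
have := unpairK n; rewrite pair_numE (addnC _ (unpair1 n)) /diagonal.
rewrite /unpair1 /unpair2 [Cantor.of_nat n.+1]/=.
by case: (Cantor.of_nat n) => [[|x] y] /= e; case: eqP; lia.
Qed.

Lemma recursive_diagonal : recursive1 diagonal.
Proof.
apply: (@recursive1_rec 0 (fun n d => if n == triangle d + d then d.+1 else d)) =>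
  // [|n]; last exact: diagonalS.
by recursive.
Qed.

#[local] Hint Resolve recursive_diagonal : recursive.

Lemma recursive_unpair2 : recursive1 unpair2.
Proof.
apply: (@eq_recursive _ (fun xs => nth 0 xs 0 - triangle (diagonal (nth 0 xs 0)))).
  by move=> xs; rewrite unpair2E.
by recursive.
Qed.

#[local] Hint Resolve recursive_unpair2 : recursive.

Lemma recursive_unpair1 : recursive1 unpair1.
Proof.
apply: (@eq_recursive _ (fun xs => diagonal (nth 0 xs 0) - unpair2 (nth 0 xs 0))).
  by move=> xs; rewrite unpair1E.
by recursive.
Qed.

#[local] Hint Resolve recursive_pair recursive_unpair1 : recursive.

(** * Injectivity of Goedel numbers *)

Lemma existT_inj (A : eqType) (P : A -> Type) a (p q : P a) :
  existT P a p = existT P a q -> p = q.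
Proof. exact: (Eqdep_dec.inj_pair2_eq_dec _ (@eq_comparable A)). Qed.

Section Injectivity.
Variables (Sg : signature) (N : numbering Sg).

Lemma existT_term_inj s (t u : term s) :
  existT (@term Sg) s t = existT (@term Sg) s u -> t = u.
Proof. exact: existT_inj. Qed.

Lemma existT_terms_inj ss (ts us : terms ss) :
  existT (@terms Sg) ss ts = existT (@terms Sg) ss us -> ts = us.
Proof. exact: (@existT_inj (seq (sorts Sg))). Qed.

(** Equal codes are not known to come from terms of one sort, so the induction recovers the sort
    too: from its number for a variable, from the function symbol otherwise. *)
Fixpoint term_num_existT s (t : term s) : forall s' (u : term s'),
    term_num N t = term_num N u -> existT (@term Sg) s t = existT (@term Sg) s' u
with terms_num_existT ss (ts : terms ss) : forall ss' (us : terms ss'),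
    terms_num N ts = terms_num N us ->
    existT (@terms Sg) ss ts = existT (@terms Sg) ss' us.
Proof.
- case: t => [s0 m|f ts] s' [s1 n|g us] //= /pair_num_inj[] // _ /pair_num_inj[].
    by move=> /sort_num_inj-> ->.
  move=> /fsym_num_inj fg; case: g / fg us => us /terms_num_existT.
  by move=> /existT_terms_inj->.
- case: ts => [|s0 ss0 t ts] ss' [|s1 ss1 u us] //= [] /pair_num_inj[].
  move=> /term_num_existT tu /terms_num_existT tsus.
  have e1 : s0 = s1 by case: tu.
  case: s1 / e1 u tu => u /existT_term_inj->.
  have e2 : ss0 = ss1 by case: tsus.
  by case: ss1 / e2 us tsus => us /existT_terms_inj->.
Qed.

Lemma terms_num_inj ss : injective (@terms_num _ N ss).
Proof.
by move=> ts us /terms_num_existT/existT_terms_inj.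
Qed.

Lemma var_num_inj : injective (var_num N).
Proof. by move=> [s m] [s' n] /pair_num_inj[/sort_num_inj/= -> ->]. Qed.

Lemma formula_num_inj : injective (formula_num N).
Proof.
elim=> [||s t u|p ts|phi IH|phi IH psi IH'|phi IH psi IH'|phi IH psi IH'
  |x phi IH|x phi IH] [||s' t' u'|p' ts'|phi'|phi' psi'|phi' psi'|phi' psi'
  |x' phi'|x' phi'] /pair_num_inj[] // _.
- move=> /pair_num_inj[/term_num_existT tt' /term_num_existT].
  have e : s = s' by case: tt'.
  case: s' / e t' u' tt' => t' u'.
  move=> /existT_term_inj->.
  by move=> /existT_term_inj->.
- move=> /pair_num_inj[/psym_num_inj e].
  by case: p' / e ts' => ts' /terms_num_inj->.
- by move=> /IH->.
- by move=> /pair_num_inj[/IH-> /IH'->].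
- by move=> /pair_num_inj[/IH-> /IH'->].
- by move=> /pair_num_inj[/IH-> /IH'->].
- by move=> /pair_num_inj[/var_num_inj-> /IH->].
- by move=> /pair_num_inj[/var_num_inj-> /IH->].
Qed.

End Injectivity.

(** * Boolean combinations of equations between variables *)

Section EquationalFormulas.
Variable Sg : signature.
Implicit Types (phi psi : formula Sg) (V : seq (var Sg)).

Definition var_term (s : sorts Sg) (t : term s) : bool :=
  if t is @Var _ _ _ then true else false.

(* [Not] and [And] may be nested freely: a class larger than the flat
   conjunctions, but with a simpler recursive definition. *)
Fixpoint equational (l : seq (sorts Sg)) phi : bool :=
  match phi with
  | Top => true
  | Eq s t u => [&& var_term t, var_term u & s \in l]
  | Not phi => equational l phi
  | And phi psi => equational l phi && equational l psi
  | _ => false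
  end.

Lemma equational_qf l phi : equational l phi -> quantifier_free phi.
Proof. by elim: phi => //= phi IH psi IH' /andP[/IH-> /IH'->]. Qed.

Lemma var_termP (s : sorts Sg) (t : term s) : var_term t -> is_var t.
Proof. by case: t => // s' n _; exists n. Qed.

Lemma is_var_var_term (s : sorts Sg) (t : term s) : is_var t -> var_term t.
Proof. by case=> n ->. Qed.

Lemma equational_vars l phi x : equational l phi -> x \in vars phi -> x.1 \in l.
Proof.
elim: phi => //= [s t u|phi IH psi IH'].
  case/and3P => /var_termP[m ->] /var_termP[n ->] sl.
  by rewrite !inE => /orP[] /eqP->.
by case/andP=> /IH h /IH' h'; rewrite mem_cat => /orP[].
Qed.

(** An algebraic signature excludes the literals with a predicate symbol, and [only_vars_in] those
    with a function symbol. *)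
Lemma flat_equational (S : sorts Sg -> Prop) l psi :
  algebraic Sg -> (forall s, S s -> s \in l) ->
  flat_conjunction psi -> only_vars_in S psi -> equational l psi.
Proof.
move=> alg Sl; elim=> {psi} [|psi|phi psi _ IH _ IH'] //=.
  case=> [s m n [[/Sl]] | s m n [[/Sl]] | f n ts _ [_ [_ /is_var_var_term]] | p | p] //=;
    by case: (alg p).
by case=> /IH-> /IH'->.
Qed.

Definition agree_on V (A B : interpretation Sg) : Prop :=
  {in V &, forall x y, x.1 = y.1 -> sat A (eq_var x y) <-> sat B (eq_var x y)}.

Lemma equational_agree V A B l psi :
  agree_on V A B -> equational l psi -> {subset vars psi <= V} ->
  sat A psi <-> sat B psi.
Proof.
move=> AB; rewrite /sat; elim: psi => //= [s t u|psi IH|phi IH psi IH'].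
- case/and3P => /var_termP[m ->] /var_termP[n ->] _ sV.
  by apply: (AB (s, m) (s, n)) => //; apply: sV; rewrite !inE eqxx ?orbT.
- by move=> /IH h /h ->.
- case/andP=> /IH h /IH' h' sV.
  rewrite h ?h' // => x xv; apply: sV; rewrite mem_cat xv ?orbT //.
Qed.

Lemma sat_conj_map (I : eqType) (F : I -> formula Sg) (r : seq I) A :
  sat A (conj [seq F i | i <- r]) <-> {in r, forall i, sat A (F i)}.
Proof.
elim: r => [|i r IH]; first by split.
split=> [[Ai /IH Ar] j|Ar]; first by rewrite inE => /orP[/eqP->|/Ar].
split; first by apply: Ar; rewrite inE eqxx.
by apply/IH => j jr; apply: Ar; rewrite inE jr orbT.
Qed.

Lemma vars_conj_map (I : eqType) (F : I -> formula Sg) (r : seq I) x :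
  (x \in vars (conj [seq F i | i <- r])) = has (fun i => x \in vars (F i)) r.
Proof. by elim: r => //= i r IH; rewrite mem_cat IH. Qed.

Lemma sat_arrangement V E A :
  sat A (arrangement V E) <->
  {in V &, forall x y, x.1 = y.1 -> E x y <-> sat A (eq_var x y)}.
Proof.
rewrite /arrangement sat_conj_map; split=> [AV x y xV yV xy|AV [x y]].
  have := AV (x, y); rewrite mem_filter /= xy eqxx allpairs_f //= => /(_ isT).
  by case: (E x y).
rewrite mem_filter /= => /andP[/eqP xy /allpairsP[[x' y'] /= [xV yV [ex ey]]]].
have := AV x y; rewrite ex ey in xy * => /(_ xV yV xy); case: (E x' y') => h.
  exact/h.
by move/h.
Qed.

Lemma vars_arrangement V E : {subset vars (arrangement V E) <= V}.
Proof.
move=> z; rewrite /arrangement vars_conj_map => /hasP[[x y]].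
rewrite mem_filter => /andP[/eqP /= xy /allpairsP[[x' y'] /= [xV yV [ex ey]]]].
have -> : vars (if E x y then eq_var x y else Not (eq_var x y)) = [:: x; y].
  by case: (E x y); case: x y xy {ex ey} => [s m] [s' n] /= ->.
by rewrite !inE ex ey => /orP[] /eqP->.
Qed.

(** Arrangements take a Boolean relation, so the truth of an equation is decided classically. The
    sorts are compared because [eq_var x y] reads [y] at the sort of [x]. *)
Definition induced_rel (A : interpretation Sg) : rel (var Sg) :=
  fun x y => (x.1 == y.1) &&
    (if excluded_middle_informative (sat A (eq_var x y)) then true else false).

Lemma induced_relP A x y :
  reflect (x.1 = y.1 /\ sat A (eq_var x y)) (induced_rel A x y).
Proof.
rewrite /induced_rel; case: excluded_middle_informative => h.
  by rewrite andbT; apply: (iffP eqP) => [|[]].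
by rewrite andbF; constructor => -[].
Qed.

Lemma induced_rel_arrangement V A : arrangement_rel V (induced_rel A).
Proof.
have sym x y : induced_rel A x y -> induced_rel A y x.
  case/induced_relP; case: x y => [s m] [s' n] /= e; case: s' / e => h.
  by apply/induced_relP; split.
have trans x y z : induced_rel A x y -> induced_rel A y z -> induced_rel A x z.
  case/induced_relP; case: x y z => [s m] [s' n] [s'' k] /= e.
  case: s' / e => h /induced_relP[/= e]; case: s'' / e => h'.
  by apply/induced_relP; split=> //; rewrite /sat /= in h h' *; rewrite h.
split=> [x y z _ _ _|x y _ _ /induced_relP[]//]; split.
  by apply/induced_relP; split=> //; rewrite /sat; case: x.
by move=> xy; apply/idP/idP; apply: trans => //; apply: sym.
Qed.

Lemma sat_induced_arrangement V A : sat A (arrangement V (induced_rel A)).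
Proof.
by apply/sat_arrangement => x y _ _ xy; split=> [/induced_relP[]//|h]; apply/induced_relP.
Qed.

Lemma arrangement_agree V A B :
  sat B (arrangement V (induced_rel A)) -> agree_on V A B.
Proof.
move=> /sat_arrangement hB x y xV yV xy; rewrite -(hB x y) //.
by have /sat_arrangement -> := sat_induced_arrangement V A.
Qed.

End EquationalFormulas.

(** * Recognizing equational formulas by their numbers *)

(** On codes of binary connectives these give the codes of the two subformulas, and on codes of
    equations those of the two sides. *)
Definition left n := unpair1 (unpair2 n).
Definition right n := unpair2 (unpair2 n).

Lemma recursive_left : recursive1 left.
Proof. by rewrite /left; recursive. Qed.

Lemma recursive_right : recursive1 right.
Proof. by rewrite /right; recursive. Qed.

Definition drop_pairs i t := iter i unpair2 t.

Lemma recursive_drop_pairs : recursive2 drop_pairs.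
Proof. by apply: (@recursive2_rec id (fun _ y _ => unpair2 y)) => //; recursive. Qed.

#[local] Hint Resolve recursive_left recursive_right recursive_drop_pairs : recursive.

Section Recognition.
Variable l : seq nat.

(* Course-of-values recursion: [recognize_table n] codes the list of the values
   of [recognize] at n - 1, ..., 0, and [entry n t i] reads off the value at i. *)
Definition entry n t i := unpair1 (drop_pairs (n - i.+1) t).

(** The tags 0, 2, 4 and 5 belong to [Top], [Eq], [Not] and [And]. Both sides of an equation must
    carry the tag 0 of variables, and [left (left n)] is then the number of the sort. *)
Definition recognize_step n t : bool :=
  (unpair1 n == 0) ||
  ((unpair1 n == 2) && ((unpair1 (left n) == 0) &&
     ((unpair1 (right n) == 0) && (left (left n) \in l)))) ||
  ((unpair1 n == 4) && (entry n t (unpair2 n) == 1)) ||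
  ((unpair1 n == 5) &&
     ((entry n t (left n) == 1) && (entry n t (right n) == 1))).

Fixpoint recognize_table n : nat :=
  if n is m.+1 then pair_num (recognize_step m (recognize_table m)) (recognize_table m)
  else 0.

Definition recognize n : nat := recognize_step n (recognize_table n).

Lemma recursive_recognize : recursive1 recognize.
Proof.
have rstep : recursive2 recognize_step by rewrite /recognize_step /entry; recursive.
have rtable : recursive1 recognize_table.
  by apply: (@recursive1_rec 0 (fun n t => pair_num (recognize_step n t) t)) => //;
    recursive.
by apply: (recursive_app2 rstep); recursive.
Qed.

Lemma entryE n i : i < n -> entry n (recognize_table n) i = recognize i.
Proof.
rewrite /entry /drop_pairs; elim: n => // n IH.
rewrite ltnS leq_eqVlt => /predU1P[->|lt_in].
  by rewrite subnn /= unpair1K.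
by rewrite subSS -(IH lt_in) -[n - i]subnSK // iterSr /= unpair2K.
Qed.

End Recognition.

Section Codes.
Variables (Sg : signature) (N : numbering Sg).
Implicit Types phi psi omega chi : formula Sg.

Local Notation num := (formula_num N).

Lemma term_num_var (s : sorts Sg) (t : term s) :
  (unpair1 (term_num N t) == 0) = var_term t.
Proof. by case: t => [s' n|f ts] /=; rewrite unpair1K. Qed.

Lemma recognizeE (l : seq (sorts Sg)) phi :
  recognize [seq sort_num N s | s <- l] (num phi) = equational l phi.
Proof.
elim: phi => [||s t u|p ts|phi IH|phi IH psi IH'|phi IH psi IH'|phi IH psi IH'
  |x phi IH|x phi IH];
  rewrite /recognize /recognize_step /left /right [num _]/= !unpair1K ?unpair2K //=.
- rewrite ?unpair1K ?unpair2K !term_num_var.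
  case: (boolP (var_term t)) => [/var_termP[n ->]|_] //=.
  by rewrite !unpair2K !unpair1K (mem_map (@sort_num_inj _ N)) !orbF.
(* The tag is positive, so the code of an immediate subformula is smaller and its value is in the
   table. *)
- by rewrite orbF entryE ?ltn_pair2 // IH; case: (equational l phi).
- rewrite unpair1K entryE ?IH ?entryE ?IH'; last 2 first.
  + by apply: (leq_ltn_trans (leq_pair2 (num phi) _)); apply: ltn_pair2.
  + by apply: (leq_ltn_trans (leq_pair1 _ (num psi))); apply: ltn_pair2.
  by case: (equational l phi); case: (equational l psi).
Qed.

(* The tautology [Or Top phi] records the formula that [omega] comes from. *)
Definition stamp phi omega psi := And (Or Top phi) (And omega psi).

(** Here 5 and 6 are the tags of [And] and [Or], and 0 is the code of [Top]. Only the shape is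
    tested; [omega] is compared with [wit phi] in [restamp_test]. *)
Definition stamped_code n : bool :=
  (unpair1 n == 5) && ((unpair1 (left n) == 5) && ((unpair1 (left (left n)) == 6) &&
  ((left (left (left n)) == 0) && (unpair1 (right (left n)) == 5)))).

Lemma left_right_num chi :
  match chi with
  | And phi psi | Or phi psi => left (num chi) = num phi /\ right (num chi) = num psi
  | _ => True
  end.
Proof. by case: chi => //= *; rewrite /left /right !unpair2K unpair1K. Qed.

Lemma num_And_inv chi :
  unpair1 (num chi) = 5 -> exists phi psi, chi = And phi psi.
Proof.
case: chi => [||s t u|p ts|?|a b|? ?|? ?|? ?|? ?]; rewrite /= unpair1K //.
by exists a, b.
Qed.

Lemma num_Or_inv chi :
  unpair1 (num chi) = 6 -> exists phi psi, chi = Or phi psi.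
Proof.
case: chi => [||s t u|p ts|?|? ?|a b|? ?|? ?|? ?]; rewrite /= unpair1K //.
by exists a, b.
Qed.

Lemma stamped_codeP chi :
  reflect (exists phi omega psi psi', chi = And (stamp phi omega psi) psi')
          (stamped_code (num chi)).
Proof.
have lA a b : left (num (And a b)) = num a := (left_right_num (And a b)).1.
have rA a b : right (num (And a b)) = num b := (left_right_num (And a b)).2.
have lO a b : left (num (Or a b)) = num a := (left_right_num (Or a b)).1.
apply: (iffP idP) => [|[phi [omega [psi [psi' ->]]]]]; last first.
  by rewrite /stamped_code /stamp !(lA, rA, lO) /= !unpair1K.
case/andP=> /eqP/num_And_inv[a [psi' ->]]; rewrite lA.
case/andP=> /eqP/num_And_inv[b [c ->]]; rewrite lA rA.
case/andP=> /eqP/num_Or_inv[d [phi ->]]; rewrite lO.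
case/andP=> /eqP d0 /eqP/num_And_inv[omega [psi ->]].
by exists phi, omega, psi, psi'; rewrite /stamp (@formula_num_inj _ N d Top).
Qed.

End Codes.

(** * A computable stamping function *)

Section Restamping.
Variables (Sg : signature) (N : numbering Sg) (l : seq (sorts Sg)).
Variable wit : QF Sg -> QF Sg.
Implicit Types (phi chi : QF Sg) (psi : formula Sg).

Local Notation num := (formula_num N).

Definition restamps (chi chi' : formula Sg) : Prop :=
  exists phi psi psi', [/\ equational l psi, equational l psi',
    chi = And (stamp phi (wit phi) psi) psi' &
    chi' = stamp phi (wit phi) (And psi psi')].

(** A fresh stamp stays allowed where restamping is possible, since the witness properties hold for
    either result. Only additivity requires restamping to be preferred. *)
Definition stamps (chi chi' : QF Sg) : Prop :=
  restamps chi chi' \/ chi' = stamp chi (wit chi) Top :> formula Sg.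

Lemma QF_inj phi chi : phi = chi :> formula Sg -> phi = chi.
Proof.
case: phi chi => [phi qphi] [chi qchi] /= e; case: chi / e qchi => qchi.
by rewrite (bool_irrelevance qphi qchi).
Qed.

Let srts := [seq sort_num N s | s <- l].

(** The argument [w] stands for the code of [wit phi], with [phi] the recorded formula. Thanks to
    the record, [wit phi] can be recomputed and compared, instead of searching for a preimage under
    [wit]. *)
Definition restamp_test n w : bool :=
  (stamped_code n && (left (right (left n)) == w)) &&
  ((recognize srts (right (right (left n))) == 1) && (recognize srts (right n) == 1)).

Definition stamp_output n w w' :=
  if restamp_test n w then
    pair_num 5 (pair_num (left (left n)) (pair_num 5 (pair_num w
      (pair_num 5 (pair_num (right (right (left n))) (right n))))))
  else pair_num 5 (pair_num (pair_num 6 (pair_num 0 n))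
      (pair_num 5 (pair_num w' 0))).

(** The default 0 is the code of [Top]: the program for [wit] is run on the result in every case,
    and it is only known to halt on codes of quantifier-free formulas. *)
Definition stamp_query n := if stamped_code n then right (left (left n)) else 0.

(** Numbers are never decoded into formulas: for each [chi] a formula is exhibited whose code the
    program outputs, and choice gathers these formulas into [f]. The last clause makes [f] restamp
    whenever this is possible. *)
Lemma stamp_computable :
  computable N wit -> exists2 f, computable N f & forall chi,
    stamps chi (f chi) /\
    forall chi' : formula Sg, restamps chi chi' -> restamps chi (f chi).
Proof.
case=> p hp.
have [q hq] : recursive1 stamp_query.
  by rewrite /stamp_query /stamped_code; recursive.
have rrec := recursive_recognize srts.
have [r hr] : recursive3 stamp_output.
  by rewrite /stamp_output /restamp_test /stamped_code; recursive.
(* The program for [wit] is run both on the recorded formula and on the input, before any case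
   distinction. *)
pose prog := Comp r [:: Proj 0; Comp p [:: q]; p].
suff /functional_choice[f hf] : forall chi, exists chi' : QF Sg,
    run prog [:: num chi] (num chi') /\
    (stamps chi chi' /\
       forall chi'' : formula Sg, restamps chi chi'' -> restamps chi chi').
  exists f => [|chi]; last by case: (hf chi).
  by exists prog => chi; case: (hf chi).
move=> chi.
have run_prog (phi : QF Sg) z : stamp_query (num chi) = num phi ->
    stamp_output (num chi) (num (wit phi)) (num (wit chi)) = z ->
    run prog [:: num chi] z.
  move=> qphi <-.
  apply: (run_comp _ (hr [:: num chi; num (wit phi); num (wit chi)] erefl)).
  apply: runs_cons; first exact: run_proj.
  apply: runs_cons; last by apply: runs_cons; [apply: hp | apply: runs_nil].
  apply: (@run_comp _ _ _ [:: num phi]); last exact: hp.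
  by apply: runs_cons; [rewrite -qphi; apply: (hq [:: num chi]) | apply: runs_nil].
have lA a b : left (num (And a b)) = num a := (left_right_num N (And a b)).1.
have rA a b : right (num (And a b)) = num b := (left_right_num N (And a b)).2.
have rO a b : right (num (Or a b)) = num b := (left_right_num N (Or a b)).2.
have numE := (lA, rA, rO).
have qfstamp : quantifier_free (stamp chi (wit chi) Top).
  by rewrite /= !qf_formulaP.
have [/stamped_codeP|unstamped] := boolP (stamped_code (num chi)); last first.
  exists (MkQF qfstamp); split; last first.
    split=> [|chi' [phi [psi [psi' [_ _ e _]]]]]; first by right.
    by case/stamped_codeP: unstamped; rewrite e; exists phi, (wit phi), psi, psi'.
  apply: (@run_prog (@MkQF Sg Top isT)).
    by rewrite /stamp_query (negPf unstamped).
  by rewrite /stamp_output /restamp_test (negPf unstamped).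
move=> [phi0 [omega [psi [psi' e]]]].
have qphi : quantifier_free phi0.
  by have := qf_formulaP chi; rewrite e /= => /andP[/andP[]].
pose phi := MkQF qphi.
have coded : stamped_code (num chi).
  by apply/stamped_codeP; exists phi0, omega, psi, psi'.
have query : stamp_query (num chi) = num phi.
  by rewrite /stamp_query coded e !numE.
have testE : restamp_test (num chi) (num (wit phi)) =
    [&& num omega == num (wit phi), equational l psi & equational l psi'].
  by rewrite /restamp_test coded e !numE !recognizeE !eqb1.
have [test|test] := boolP (restamp_test (num chi) (num (wit phi))).
  have := test; rewrite testE => /and3P[/eqP/formula_num_inj eo lpsi lpsi'].
  have qf : quantifier_free (stamp phi (wit phi) (And psi psi')).
    by rewrite /= !qf_formulaP (equational_qf lpsi) (equational_qf lpsi') qphi.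
  have res : restamps chi (MkQF qf).
    by exists phi, psi, psi'; split; rewrite // e eo.
  exists (MkQF qf); split; last by split; [left|].
  by apply: (run_prog _ _ query); rewrite /stamp_output test e !numE.
exists (MkQF qfstamp); split; last first.
  split=> [|chi' [phi' [psi1 [psi1' [l1 l1' e' _]]]]]; first by right.
  (* The formula recorded in [chi] is unique, so another decomposition would contradict the failed
     test. *)
  case/negP: test; rewrite testE; move: e' l1 l1'; rewrite e => -[e1 -> -> ->].
  by rewrite (@QF_inj phi phi' e1) eqxx => -> ->.
by apply: (run_prog _ _ query); rewrite /stamp_output (negPf test).
Qed.

End Restamping.

(** * Witnesses *)

Section Coincidence.
Variables (Sg : signature) (M : structure Sg).
Implicit Types nu mu : assignment M.

Fixpoint eval_eq_in nu mu s (t : term s) :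
  {in term_vars t, forall x, nu x = mu x} -> eval nu t = eval mu t
with evals_eq_in nu mu ss (ts : terms ss) :
  {in terms_vars ts, forall x, nu x = mu x} -> evals nu ts = evals mu ts.
Proof.
- case: t => [s' n|f ts] h /=; first by apply: (h (s', n)); rewrite inE.
  by rewrite (evals_eq_in nu mu).
- case: ts => [|s' ss' t ts] h //=.
  rewrite (eval_eq_in nu mu); last by move=> x xt; apply: h; rewrite mem_cat xt.
  by rewrite (evals_eq_in nu mu) // => x xt; apply: h; rewrite mem_cat xt orbT.
Qed.

(** This serves the quantifier cases: [mu'] takes the value of [nu'] at [x] and those of [mu]
    elsewhere. *)
Lemma variant_eq_in x nu mu nu' (r : seq (var Sg)) :
  {in [seq y <- r | y != x], forall y, nu y = mu y} -> variant x nu nu' ->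
  exists2 mu', variant x mu mu' & {in r, forall y, nu' y = mu' y}.
Proof.
move=> e v; exists (fun y => if y == x then nu' y else mu y).
  by move=> y /negPf->.
move=> y yr; case: eqP => // /eqP yx; rewrite v // e //.
by rewrite mem_filter yx.
Qed.

Lemma holds_eq_in phi nu mu :
  {in vars phi, forall x, nu x = mu x} -> holds nu phi <-> holds mu phi.
Proof.
elim: phi nu mu => [||s t u|p ts|phi IH|phi IH psi IH'|phi IH psi IH'
  |phi IH psi IH'|x phi IH|x phi IH] nu mu //= h.
- rewrite (@eval_eq_in nu mu _ t) ?(@eval_eq_in nu mu _ u) //.
    by move=> x xu; apply: h; rewrite mem_cat xu orbT.
  by move=> x xt; apply: h; rewrite mem_cat xt.
- by rewrite (evals_eq_in h).
- by rewrite (IH nu mu).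
- by rewrite (IH nu mu) ?(IH' nu mu) // => x xv; apply: h; rewrite mem_cat xv ?orbT.
- by rewrite (IH nu mu) ?(IH' nu mu) // => x xv; apply: h; rewrite mem_cat xv ?orbT.
- by rewrite (IH nu mu) ?(IH' nu mu) // => x xv; apply: h; rewrite mem_cat xv ?orbT.
- have h' : {in [seq y <- vars phi | y != x], forall y, mu y = nu y}.
    by move=> y yx; rewrite h.
  split=> -[nu' [v hphi]].
    by have [mu' v' e] := variant_eq_in h v; exists mu'; split=> //; apply/(IH nu').
  by have [mu' v' e] := variant_eq_in h' v; exists mu'; split=> //; apply/(IH nu').
- have h' : {in [seq y <- vars phi | y != x], forall y, mu y = nu y}.
    by move=> y yx; rewrite h.
  split=> hphi nu' v.
    by have [mu' v' e] := variant_eq_in h' v; apply/(IH nu' mu') => //; apply: hphi.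
  by have [mu' v' e] := variant_eq_in h v; apply/(IH nu' mu') => //; apply: hphi.
Qed.

(** Axioms are closed, so membership in the theory depends on the structure alone. *)
Lemma in_theory_assign (T : theory Sg) nu mu :
  in_theory T (Interpretation nu) -> in_theory T (Interpretation mu).
Proof.
move=> Tnu phi ax; have := Tnu phi ax; rewrite /sat /= => h.
by apply: (holds_eq_in _).1 h => x; rewrite (axioms_closed ax).
Qed.

End Coincidence.

(** * Witness properties and additivity of the stamping function *)

Section Witnesses.
Variables (Sg : signature) (N : numbering Sg) (T : theory Sg) (S : sorts Sg -> Prop).

Lemma sat_exs xs (phi psi : formula Sg) A :
  (forall B, sat B phi <-> sat B psi) -> sat A (exs xs phi) <-> sat A (exs xs psi).
Proof.
move=> e; case: A => M nu; rewrite /sat /=.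
elim: xs nu => [|x xs IH] nu /=; first exact: (e (Interpretation nu)).
by split=> -[mu [v h]]; exists mu; split=> //; apply/IH.
Qed.

Lemma exs_T_sat xs (phi : formula Sg) : T_sat T (exs xs phi) -> T_sat T phi.
Proof.
case=> -[M nu] [TA]; rewrite /sat /= => h.
elim: xs nu TA h => [|x xs IH] nu TA /=; first by exists (Interpretation nu).
by case=> mu [_ h]; apply: (IH mu) => //; apply: in_theory_assign TA.
Qed.

Lemma domain_by_vars_sub A (phi psi : formula Sg) :
  {subset vars phi <= vars psi} -> domain_by_vars S A phi -> domain_by_vars S A psi.
Proof. by move=> sub dA s Ss a; have [n [/sub ? ?]] := dA s Ss a; exists n. Qed.

Lemma witness_finite_sorts wit :
  witness N T S wit -> T_sat T Top -> exists l : seq (sorts Sg), forall s, S s <-> s \in l.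
Proof.
case=> _ hw [A [TA _]]; have [equiv dom] := hw (@MkQF Sg Top isT).
have [B [_ _ dB]] : exists B, [/\ in_theory T B, sat B (wit (@MkQF Sg Top isT)) &
    domain_by_vars S B (wit (@MkQF Sg Top isT))].
  by apply: dom; apply: exs_T_sat; exists A; split=> //; apply/equiv.
have sub s : S s -> s \in [seq x.1 | x <- vars (wit (@MkQF Sg Top isT))].
  (* Domains are non-empty, so each sort in [S] needs a variable in the witness formula of [Top]. *)
  move=> Ss; have [a] := dom_inh B s; have [n [xv _]] := dB s Ss a.
  by apply/mapP; exists (s, n).
(* Sorts outside [S] are filtered out classically. This does not harm computability, because the
   list is a fixed finite parameter of the later program. *)
exists [seq s <- [seq x.1 | x <- vars (wit (@MkQF Sg Top isT))]
       | if excluded_middle_informative (S s) then true else false] => s.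
rewrite mem_filter; case: excluded_middle_informative => h; last by split.
by split=> // _; apply: sub.
Qed.

Lemma strong_witness_equational (l : seq (sorts Sg)) wit (phi : QF Sg) psi :
  (forall s, s \in l -> S s) -> strong_witness N T S wit -> equational l psi ->
  T_sat T (And (wit phi) psi) ->
  exists A, [/\ in_theory T A, sat A (And (wit phi) psi) &
                domain_by_vars S A (And (wit phi) psi)].
Proof.
move=> lS [_ sw] lpsi [A [TA [Aw Apsi]]].
(* The arrangement is the one that the given model induces on the variables of [psi]; every model of
   it gives [psi] the same truth value. *)
pose V := vars psi; pose E := induced_rel A.
have [||| B [TB [Bw /arrangement_agree AB] dB]] := sw phi V E.
- by move=> x /(equational_vars lpsi)/lS.
- exact: induced_rel_arrangement.
- by exists A; split=> //; split=> //; apply: sat_induced_arrangement.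
exists B; split=> //.
  by split=> //; apply/(equational_agree AB lpsi).
apply: domain_by_vars_sub dB => x /=; rewrite !mem_cat.
by case/orP=> [->//|/vars_arrangement xV]; rewrite xV orbT.
Qed.

Lemma sat_stamp A (phi omega psi : formula Sg) :
  sat A (stamp phi omega psi) <-> sat A (And omega psi).
Proof. by rewrite /sat /=; tauto. Qed.

(** Up to the tautology that both contain, the two formulas are the same conjunction, bracketed
    differently. *)
Lemma restamps_sat l wit (chi chi' : formula Sg) A :
  restamps l wit chi chi' -> sat A chi' <-> sat A chi.
Proof. by case=> phi [psi [psi' [_ _ -> ->]]]; rewrite /sat /=; tauto. Qed.

Lemma restamps_vars l wit (chi chi' : formula Sg) :
  restamps l wit chi chi' -> vars chi' =i vars chi.
Proof. by case=> phi [psi [psi' [_ _ -> ->]]] x; rewrite /= !mem_cat -!orbA. Qed.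

(** Fresh stamps and restamped formulas share this form, which is what a later restamping looks
    for. *)
Lemma stamps_shape l wit (chi chi' : QF Sg) :
  stamps l wit chi chi' -> exists (phi : QF Sg) psi,
    equational l psi /\ chi' = stamp phi (wit phi) psi :> formula Sg.
Proof.
case=> [[phi [psi [psi' [lpsi lpsi' _ ->]]]]|->]; last by exists chi, Top.
by exists phi, (And psi psi'); rewrite /= lpsi lpsi'.
Qed.

Lemma stamps_T_equiv l wit (chi chi' : QF Sg) :
  witness N T S wit -> stamps l wit chi chi' ->
  T_equiv T chi (exs (undup [seq x <- vars chi' | x \notin vars chi]) chi').
Proof.
case=> _ hw [res|e] A TA.
  (* Restamping adds no variables, so the quantifier prefix is empty. *)
  have -> : [seq x <- vars chi' | x \notin vars chi] = [::].
    rewrite (@eq_in_filter _ _ pred0) ?filter_pred0 // => x.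
    by rewrite (restamps_vars res) => ->.
  by rewrite /= (restamps_sat A res).
(* A fresh stamp adds only variables of [chi] to those of [wit chi], so the prefix is the one for
   [wit]. *)
rewrite e /= cats0 filter_cat (@eq_in_filter _ _ pred0 (vars chi)); last by move=> x ->.
rewrite filter_pred0.
rewrite ((hw chi).1 A TA); apply: sat_exs => B.
by rewrite /sat /=; tauto.
Qed.

Lemma stamps_domain (l : seq (sorts Sg)) wit (chi chi' : QF Sg) :
  (forall s, s \in l -> S s) -> strong_witness N T S wit -> stamps l wit chi chi' ->
  T_sat T chi' ->
  exists A, [/\ in_theory T A, sat A chi' & domain_by_vars S A chi'].
Proof.
move=> lS sw /stamps_shape[phi [psi [lpsi ->]]] [A [TA /sat_stamp hA]].
have [|B [TB hB dB]] := @strong_witness_equational _ _ phi _ lS sw lpsi.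
  by exists A.
exists B; split=> //; first exact/sat_stamp.
apply: domain_by_vars_sub dB => x xv.
rewrite -[vars (stamp _ _ _)]/(vars (Or Top phi) ++ vars (And (wit phi) psi)).
by rewrite mem_cat xv orbT.
Qed.

Lemma stamps_additive (l : seq (sorts Sg)) wit f :
  algebraic Sg -> (forall s, S s -> s \in l) ->
  (forall chi, stamps l wit chi (f chi) /\
    forall chi' : formula Sg, restamps l wit chi chi' -> restamps l wit chi (f chi)) ->
  additive T S f.
Proof.
move=> alg Sl hf phi psi flat only.
have lpsi := flat_equational alg Sl flat only.
have [phi0 [psi0 [lpsi0 e]]] := stamps_shape (hf phi).1.
(* The output on [phi] is already stamped, so its conjunction with [psi] admits a restamping and [f]
   has to perform one. *)
have res : restamps l wit (qf_and (f phi) psi) (f (qf_and (f phi) psi)).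
  apply: ((hf _).2 (stamp phi0 (wit phi0) (And psi0 psi))).
  by exists phi0, psi0, psi; split; rewrite //= e.
split=> [A _|x _]; first exact: restamps_sat res.
exact: (restamps_vars res x).
Qed.

End Witnesses.

Theorem theorem5 (Sg : signature) (N : numbering Sg) (T : theory Sg)
    (S : sorts Sg -> Prop) :
  algebraic Sg -> strongly_polite N T S -> additively_polite N T S.
Proof.
move=> alg [smoothT [wit sw]]; split=> //; have [w _] := sw.
have [satT|unsatT] := classic (T_sat T Top); last first.
  (* Without models [S] may be infinite, but the identity serves: the semantic conditions are
     vacuous and the condition on variables is trivial. *)
  have inconsistent A : ~ in_theory T A by move=> TA; apply: unsatT; exists A.
  exists id; split; last by move=> phi psi _ _; split=> // A /inconsistent.
  split; first by exists (Proj 0) => phi; apply: run_proj.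
  by move=> phi; split=> [A /inconsistent|[A [/inconsistent]]].
have [l Sl] := witness_finite_sorts w satT.
have lS s : s \in l -> S s by case: (Sl s).
have {}Sl s : S s -> s \in l by case: (Sl s).
have [f cf hf] := stamp_computable l w.1.
exists f; split; last exact: (stamps_additive T alg Sl hf).
split=> // phi; split; first exact: (stamps_T_equiv w (hf phi).1).
exact: (stamps_domain lS sw (hf phi).1).
Qed.
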